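(* Let $G$ be a finite abelian group and let $\to$ be a $G$-transfer system. Then there is a $G$-universe $U$ such that $\to$ equals the transfer system $\to_{\mathcal{K}(U)}$ of the Steiner operad $\mathcal{K}(U)$ if and only if there exist an integer $n\ge 0$ and $G$-cocyclic subgroups $H_1,\dots,H_n\subset G$ such that $\to\ =\ \langle (H_i,G)\mid 1\le i\le n\rangle$.
   Context: Let $G$ be a finite group and $\mathrm{Sub}(G)$ its set of subgroups. A $G$-transfer system is a partial order $\to$ on $\mathrm{Sub}(G)$ such that: if $K\to H$ then $K\subset H$; if $K\to H$ then $gKg^{-1}\to gHg^{-1}$ for all $g\in G$; if $K\to H$ and $L\subset H$ then $K\cap L\to L$. For a binary relation $R$ on $\mathrm{Sub}(G)$ (identified with its set of related pairs $(K,H)$) such that $(K,H)\in R$ implies $K\subset H$, $\langle R\rangle$ is the smallest $G$-transfer system containing $R$. A subgroup $H\subset G$ is $G$-cocyclic if $H$ is normal in $G$ and $G/H$ is cyclic (so $H=G$ is allowed). A $G$-universe is a countably infinite dimensional real inner product space $U$ with a linear isometric $G$-action, which contains each of its (finite dimensional) subrepresentations infinitely often, and which contains trivial summands. Steiner operads: for a finite dimensional real orthogonal $G$-representation $V$, let $R_V$ be the $G$-space (under conjugation) of distance-reducing, not necessarily equivariant, embeddings $V\to V$. A $V$-Steiner path is a map $h:[0,1]\to R_V$ with $h(1)=\mathrm{id}$, and $\mathcal{K}(V)(n)$ is the $G\times\Sigma_n$-space of $n$-tuples $(h_1,\dots,h_n)$ of $V$-Steiner paths such that the images of $h_1(0),\dots,h_n(0)$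 are disjoint. Set $\mathcal{K}(U)=\mathrm{colim}_{V\subset U}\mathcal{K}(V)$, over finite dimensional subrepresentations $V\subset U$ (for $V\subset W$ one takes the product with the identity on the orthogonal complement of $V$ in $W$). For $K\subset H\subset G$ with $n=|H:K|$, let $\Gamma(H/K)=\{(h,\sigma(h))\mid h\in H\}\subset G\times\Sigma_n$ be the graph of a permutation representation $\sigma:H\to\Sigma_n$ of $H/K$. The transfer system $\to_{\mathcal{K}(U)}$ is defined by: $K\to_{\mathcal{K}(U)}H$ iff $K\subset H$ and $\mathcal{K}(U)(n)^{\Gamma(H/K)}\neq\varnothing$. By a known theorem of Blumberg and Hill, for $K\subset H$ this holds iff there is an injective $H$-equivariant map of sets $H/K\hookrightarrow \mathrm{res}^G_H U$. *)

(* Defs.v *)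
From HB Require Import structures.
From mathcomp Require Import all_boot all_order all_algebra all_fingroup all_solvable.
From mathcomp Require Import sesquilinear.
From mathcomp Require Import all_classical all_reals all_analysis.

Set Implicit Arguments.
Unset Strict Implicit.
Unset Printing Implicit Defensive.

Import Order.TTheory GRing.Theory Num.Theory.
Import numFieldNormedType.Exports.

Local Open Scope classical_set_scope.
Local Open Scope ring_scope.

(* The ambient finite group G is the whole of a finGroupType, so that
   {group gT} is exactly Sub(G). *)
Definition subgroup_relation (gT : finGroupType) :=
  {group gT} -> {group gT} -> Prop.

Record is_transfer_system (gT : finGroupType) (T : subgroup_relation gT)
    : Prop := IsTransferSystem {
  transfer_refl : forall H, T H H;
  transfer_trans : forall L K H, T L K -> T K H -> T L H;
  transfer_antisym : forall K H, T K H -> T H K -> K = H;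
  transfer_sub : forall K H, T K H -> K \subset H;
  (* [A :^ x] is x^-1 A x *)
  transfer_conj : forall K H (g : gT),
    T K H -> T (K :^ g^-1)%G (H :^ g^-1)%G;
  transfer_restrict : forall K H L : {group gT},
    T K H -> L \subset H -> T (K :&: L)%G L }.

Definition generated_transfer_system (gT : finGroupType)
    (R : subgroup_relation gT) : subgroup_relation gT :=
  fun K H => forall T, is_transfer_system T ->
    (forall A B, R A B -> T A B) -> T K H.

Lemma subset_transfer_system (gT : finGroupType) :
  is_transfer_system (fun K H : {group gT} => K \subset H).
Proof.
split=> //.
- by move=> L K H; exact: fintype.subset_trans.
- by move=> K H KH HK; apply/val_inj/eqP; rewrite finset.eqEsubset KH.
- by move=> K H g; rewrite conjSg.
- by move=> K H L _ _; exact: subsetIr.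
Qed.

Lemma generated_transfer_systemP (gT : finGroupType)
    (R : subgroup_relation gT) :
  (forall K H, R K H -> K \subset H) ->
  is_transfer_system (generated_transfer_system R) /\
  (forall K H, R K H -> generated_transfer_system R K H).
Proof.
move=> Rsub; split; last by move=> K H RKH T _; apply.
have gsub K H : generated_transfer_system R K H -> K \subset H.
  by move=> KH; apply: (KH _ (@subset_transfer_system gT)) => A B; exact: Rsub.
split=> //.
- by move=> H T /transfer_refl.
- by move=> L K H LK KH T sT RT; apply: (transfer_trans sT (LK _ sT RT) (KH _ sT RT)).
- move=> K H /gsub KH /gsub HK.
  exact: (transfer_antisym (@subset_transfer_system gT) KH HK).
- by move=> K H g KH T sT RT; apply: transfer_conj (KH _ sT RT).
- by move=> K H L KH LH T sT RT; apply: (transfer_restrict sT (KH _ sT RT)).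
Qed.

Definition cocyclic (gT : finGroupType) (H : {group gT}) : bool :=
  normal H [set: gT]%G && cyclic ([set: gT]%G / H)%g.

(* A real inner product space with a linear isometric G-action; the norm (hence
   the topology) carried by U is the one induced by the inner product. *)
Record orthogonal_rep (R : realType) (gT : finGroupType) := OrthogonalRep {
  rep_space :> normedModType R;
  rep_ip : {dot rep_space for idfun};
  rep_normE : forall x : rep_space, `|x| ^+ 2 = rep_ip x x;
  rep_act : gT -> {linear rep_space -> rep_space};
  rep_act1 : forall x, rep_act 1%g x = x;
  rep_actM : forall g h x, rep_act (g * h)%g x = rep_act g (rep_act h x);
  rep_act_ip : forall g x y,
    rep_ip (rep_act g x) (rep_act g y) = rep_ip x y }.

Record fd_subrep (R : realType) (gT : finGroupType)
    (U : orthogonal_rep R gT) := FdSubrep {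
  subrep_set :> set U;
  subrep_fin_dim : exists (n : nat) (b : 'I_n -> U),
    subrep_set = [set x | exists c : 'I_n -> R, x = \sum_(i < n) c i *: b i];
  subrep_stable : forall g x, subrep_set x -> subrep_set (rep_act U g x) }.

(* From here on a subrepresentation V : fd_subrep U is also used as the type of
   its points, via the coercion [set_type]. *)
Definition subrep_act (R : realType) (gT : finGroupType)
    (U : orthogonal_rep R gT) (V : fd_subrep U) (g : gT) (x : V) : V :=
  SigSub (mem_set (subrep_stable g (set_valP x))).

Definition countably_infinite_dim (R : realType) (E : lmodType R) : Prop :=
  exists b : nat -> E,
    (forall (n : nat) (c : 'I_n -> R),
       \sum_(i < n) c i *: b i = 0 -> forall i, c i = 0) /\
    (forall x, exists (n : nat) (c : 'I_n -> R), x = \sum_(i < n) c i *: b i).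

Definition isometric_rep_map (R : realType) (gT : finGroupType)
    (U : orthogonal_rep R gT) (V : fd_subrep U) (f : V -> U) : Prop :=
  [/\ forall (a : R) (x y z : V),
        \val z = a *: \val x + \val y -> f z = a *: f x + f y,
      forall x y : V, rep_ip U (f x) (f y) = rep_ip U (\val x) (\val y) &
      forall (g : gT) (x : V), f (subrep_act g x) = rep_act U g (f x)].

(* "U contains V infinitely often": U contains an orthogonal direct sum of
   infinitely many copies of V. *)
Definition contains_infinitely_often (R : realType) (gT : finGroupType)
    (U : orthogonal_rep R gT) (V : fd_subrep U) : Prop :=
  exists f : nat -> V -> U,
    (forall i, isometric_rep_map (f i)) /\
    (forall i j, i != j -> forall x y : V, rep_ip U (f i x) (f j y) = 0).

Record is_universe (R : realType) (gT : finGroupType)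
    (U : orthogonal_rep R gT) : Prop := IsUniverse {
  universe_dim : countably_infinite_dim U;
  universe_rep : forall V : fd_subrep U, contains_infinitely_often V;
  universe_trivial : exists2 x : U, x != 0 & forall g, rep_act U g x = x }.

Definition embedding (X Y : topologicalType) (f : X -> Y) : Prop :=
  injective f /\
  (forall A : set X, open A <-> exists2 B : set Y, open B & A = f @^-1` B).

Definition distance_reducing (R : realType) (E : normedModType R) (V : set E)
    (f : V -> V) : Prop :=
  forall x y : V, `|\val (f x) - \val (f y)| <= `|\val x - \val y|.

Definition steiner_maps (R : realType) (gT : finGroupType)
    (U : orthogonal_rep R gT) (V : fd_subrep U) : set {compact-open, V -> V} :=
  [set f | embedding (f : V -> V) /\ distance_reducing (f : V -> V)].
Arguments steiner_maps {R gT U} V _.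

Definition unit_interval (R : realType) : set R := `[0, 1].
Arguments unit_interval R : clear implicits.

Lemma unit_interval0 (R : realType) : 0 \in unit_interval R.
Proof. by apply/mem_set; rewrite /unit_interval /= in_itv /= lexx ler01. Qed.

Lemma unit_interval1 (R : realType) : 1 \in unit_interval R.
Proof. by apply/mem_set; rewrite /unit_interval /= in_itv /= lexx ler01. Qed.

Definition I0 (R : realType) : unit_interval R := SigSub (@unit_interval0 R).
Definition I1 (R : realType) : unit_interval R := SigSub (@unit_interval1 R).

Definition self_map_path (R : realType) (gT : finGroupType)
    (U : orthogonal_rep R gT) (V : fd_subrep U) : Type :=
  unit_interval R -> {compact-open, V -> V}.

(* The topology on R_V is the subspace topology of the compact-open topology. *)
Record is_steiner_path (R : realType) (gT : finGroupType)
    (U : orthogonal_rep R gT) (V : fd_subrep U) (h : self_map_path V)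
    : Prop := IsSteinerPath {
  steiner_path_mem : forall t, steiner_maps V (h t);
  steiner_path_continuous : continuous h;
  steiner_path1 : h (I1 R) = id }.

Definition steiner_operad (R : realType) (gT : finGroupType)
    (U : orthogonal_rep R gT) (V : fd_subrep U) (n : nat)
    : set ('I_n -> self_map_path V) :=
  [set h | (forall i, is_steiner_path (h i)) /\
           trivIset [set: 'I_n] (fun i => range (h i (I0 R) : V -> V))].
Arguments steiner_operad {R gT U} V n _.

(* (g, s) . (h_1, ..., h_n) has i-th entry g h_{s^-1(i)} g^-1. *)
Definition steiner_act (R : realType) (gT : finGroupType)
    (U : orthogonal_rep R gT) (V : fd_subrep U) (n : nat)
    (a : gT * {perm 'I_n}) (h : 'I_n -> self_map_path V)
    : 'I_n -> self_map_path V :=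
  fun i t x =>
    subrep_act a.1 (h ((a.2)^-1%g i) t (subrep_act (a.1)^-1%g x)).

(* F = f x id on W = V + (orthogonal complement of V in W): if v is the
   orthogonal projection of w to V, then F w = f v + (w - v). *)
Definition stabilizes_to (R : realType) (gT : finGroupType)
    (U : orthogonal_rep R gT) (V W : fd_subrep U) (f : V -> V) (F : W -> W)
    : Prop :=
  forall (v : V) (w : W),
    (forall u : V, rep_ip U (\val u) (\val w - \val v) = 0) ->
    \val (F w) = \val (f v) + (\val w - \val v).

(* The graph of the structure map K(V)(n) -> K(W)(n), for V contained in W. *)
Definition steiner_stabilizes_to (R : realType) (gT : finGroupType)
    (U : orthogonal_rep R gT) (V W : fd_subrep U) (n : nat)
    (h : 'I_n -> self_map_path V) (k : 'I_n -> self_map_path W) : Prop :=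
  V `<=` W /\ forall i t, stabilizes_to (h i t) (k i t).

(* Points of K(U)(n) = colim_V K(V)(n) are represented by points of the stages
   K(V)(n); two representatives define the same point of this directed colimit
   iff they have the same image at some later stage. *)
Definition steiner_colim_eq (R : realType) (gT : finGroupType)
    (U : orthogonal_rep R gT) (V V' : fd_subrep U) (n : nat)
    (h : 'I_n -> self_map_path V) (h' : 'I_n -> self_map_path V') : Prop :=
  exists (W : fd_subrep U) (k : 'I_n -> self_map_path W),
    [/\ steiner_operad W n k, steiner_stabilizes_to h k &
        steiner_stabilizes_to h' k].

Definition has_steiner_fixed_point (R : realType) (gT : finGroupType)
    (U : orthogonal_rep R gT) (n : nat) (Gamma : {set gT * {perm 'I_n}})
    : Prop :=
  exists (V : fd_subrep U) (h : 'I_n -> self_map_path V),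
    steiner_operad V n h /\
    (forall a, a \in Gamma -> steiner_colim_eq (steiner_act a h) h).

(* sigma is the left H-action on the set H/K of left cosets, transported along
   a numbering e of H/K. *)
Definition is_perm_rep (gT : finGroupType) (K H : {group gT}) (n : nat)
    (sigma : gT -> {perm 'I_n}) : Prop :=
  exists e : 'I_n -> {set gT},
    [/\ injective e, [set e i | i in [set: 'I_n]%SET]%SET = lcosets K H &
        forall h i, h \in H -> e (sigma h i) = (h *: e i)%g].

Definition perm_rep_graph (gT : finGroupType) (H : {group gT}) (n : nat)
    (sigma : gT -> {perm 'I_n}) : {set gT * {perm 'I_n}} :=
  [set (h, sigma h) | h in H]%SET.

Definition steiner_transfer (R : realType) (gT : finGroupType)
    (U : orthogonal_rep R gT) : subgroup_relation gT :=
  fun K H => K \subset H /\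
    exists sigma : gT -> {perm 'I_(#|H : K|%g)},
      is_perm_rep K H sigma /\
      has_steiner_fixed_point U (perm_rep_graph H sigma).

(* Main.v *)
Require Import Defs.
From HB Require Import structures.
From mathcomp Require Import all_boot all_order all_algebra all_fingroup all_solvable.
From mathcomp Require Import sesquilinear.
From mathcomp Require Import all_classical all_reals all_analysis.
From mathcomp Require Import ring lra zify.

Set Implicit Arguments.
Unset Strict Implicit.
Unset Printing Implicit Defensive.

Import Order.TTheory GRing.Theory Num.Theory.
Import numFieldNormedType.Exports.

(** A configuration in the Steiner operad that is fixed by the graph of [H / K]
    has, as the centres of its embedded copies of [V], an embedded copy of the
    [H]-set [H / K] in [U]; conversely, given such an orbit, [V] can be shrunk
    radially to small disjoint balls around its points, and [H] permutes these
    balls. So [K -> H] holds in the transfer system of the Steiner operad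
    exactly when [K = H :&: stab x] for some [x] in [U]
    ([steiner_transferE]), and the theorem becomes a question about the
    stabilizers in [G] of the vectors of [U].

    The stabilizers are closed under intersection ([stab_setI]), hence the
    relation [K = H :&: stab x] is a transfer system. If a family of
    stabilizers [H_i] is such that every stabilizer is an intersection of some
    of the [H_i], this transfer system is generated by the pairs [(H_i, G)]:
    restriction and composition produce [H :&: H_1 :&: ... :&: H_r -> H]
    ([orbit_transfer_generatedP]).

    Let [G] be abelian. For the direct implication, the cocyclic stabilizers
    form such a family. Complex characters would show this, but a computation
    in the group ring suffices: if [G / stab x] is not cyclic, it contains
    independent elements [a] and [b] of prime order [p], and [p] is a
    combination of the sums over the cyclic groups generated by the [a b^k] and
    [b^j]. If [g] moves [x], then it also moves one of the corresponding sums
    of translates of [x], whose stabilizer is strictly larger; iterating, one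
    reaches a vector moved by [g] with cocyclic stabilizer
    ([cocyclic_stab_separates]).

    For the converse, a cocyclic [H_i] is the kernel of a homomorphism to the
    rotation group of the plane ([cocyclic_character]). Let [G] act on a sum of
    countably many planes by these rotations and the trivial one, each repeated
    infinitely often ([cocyclic_universe]). Since rotations other than the
    identity fix only the origin, the stabilizers are exactly the intersections
    of the [H_i]. The planes repeat periodically, so translating the planes by
    multiples of the period gives infinitely many orthogonal copies of any
    finite dimensional subrepresentation. *)

(** * Stabilizers *)

Section Stabilizers.
Local Open Scope ring_scope.
Variables (R : realType) (gT : finGroupType) (U : orthogonal_rep R gT).
Implicit Types (x y : U) (g h : gT).

Definition stab_set x : {set gT} := [set g | rep_act U g x == x]%SET.

Lemma stabP x g : reflect (rep_act U g x = x) (g \in stab_set x).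
Proof. by rewrite inE; exact: eqP. Qed.

Lemma stab_set_group x : group_set (stab_set x).
Proof.
apply/group_setP; split=> [|g h /stabP gx /stabP hx]; apply/stabP.
  exact: rep_act1.
by rewrite rep_actM hx gx.
Qed.

Canonical stab x : {group gT} := Group (stab_set_group x).

Lemma rep_actVK g x : rep_act U g^-1%g (rep_act U g x) = x.
Proof. by rewrite -rep_actM mulVg rep_act1. Qed.

Lemma rep_actKV g x : rep_act U g (rep_act U g^-1%g x) = x.
Proof. by rewrite -rep_actM mulgV rep_act1. Qed.

Lemma rep_act_inj g : injective (rep_act U g).
Proof. exact: can_inj (rep_actVK g). Qed.

(** For each [g] that moves [x] or [y], at most one scalar [c] makes
    [x + c y] invariant under [g]; since the field is infinite, some [c]
    avoids all of these. *)
Lemma stab_setI x y : exists z, stab_set z = (stab_set x :&: stab_set y)%SET.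
Proof.
pose bad := [set g | g \notin (stab_set x :&: stab_set y)]%SET.
pose hits g (n : nat) := rep_act U g (x + n%:R *: y) == x + n%:R *: y.
have actE g c : rep_act U g (x + c *: y) = rep_act U g x + c *: rep_act U g y.
  by rewrite linearD linearZ.
have hits_uniq g m n : g \in bad -> hits g m -> hits g n -> m = n.
  rewrite !inE => gbad /eqP gm /eqP gn; apply/eqP; apply: contraNT gbad => mn.
  have dE : (m%:R - n%:R : R) *: rep_act U g y = (m%:R - n%:R) *: y.
    rewrite !scalerBl -[LHS]add0r -[in LHS](subrr (rep_act U g x)) addrACA.
    by rewrite -opprD -!actE gm gn opprD addrACA subrr add0r.
  have gy : rep_act U g y = y.
    by apply: scalerI dE; rewrite subr_eq0 eqr_nat.
  move: gm; rewrite actE gy => /addIr ->.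
  by rewrite !eqxx.
(* one candidate more than there are elements to avoid *)
have [n ngood] : exists n : nat, forall g, g \in bad -> ~~ hits g n.
  have [/existsP[n /forallP Hn]|] :=
    boolP [exists n : 'I_#|bad|.+1, forall g, (g \in bad) ==> ~~ hits g n].
    by exists n => g gb; move: (Hn g); rewrite gb.
  rewrite negb_exists => /forallP Hn.
  have Hf (n : 'I_#|bad|.+1) : exists g, (g \in bad) && hits g n.
    move: (Hn n); rewrite negb_forall => /existsP[g].
    by rewrite negb_imply negbK; exists g.
  pose f n := xchoose (Hf n).
  have fP n : (f n \in bad) && hits (f n) n := xchooseP (Hf n).
  have finj : injective f.
    move=> m n fmn; apply/val_inj/(hits_uniq (f m)).
    - by case/andP: (fP m).
    - by case/andP: (fP m).
    - by rewrite fmn; case/andP: (fP n).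
  have : (#|[set f n | n in [set: 'I_#|bad|.+1]]%SET| <= #|bad|)%N.
    apply/subset_leq_card/fintype.subsetP => g /imsetP[n _ ->].
    by case/andP: (fP n).
  by rewrite (card_imset _ finj) cardsT card_ord ltnn.
exists (x + n%:R *: y); apply/setP => g; apply/idP/idP => [/stabP gz|].
  apply/negPn/negP => gbad; have : g \in bad by rewrite inE.
  by move=> /ngood /negP; apply; rewrite /hits gz.
rewrite inE => /andP[/stabP gx /stabP gy]; apply/stabP.
by rewrite actE gx gy.
Qed.

(** The relation [K = H :&: stab x] says that the orbit of [x] under [H] is a
    copy of the [H]-set [H / K] inside [U]. *)
Definition orbit_transfer : subgroup_relation gT :=
  fun K H => exists x, K = (H :&: stab_set x)%SET :> {set gT}.

Lemma stab_setJ g x : stab_set (rep_act U g x) = (stab_set x :^ g^-1)%g.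
Proof.
apply/setP => h; rewrite mem_conjgV; apply/stabP/stabP => [hgx|].
  by rewrite conjgE !rep_actM hgx rep_actVK.
by rewrite conjgE !rep_actM => hx; apply: (@rep_act_inj g^-1%g);
  rewrite hx rep_actVK.
Qed.

Lemma orbit_transfer_system : is_transfer_system orbit_transfer.
Proof.
split.
- move=> H; exists 0; apply/esym/finset.setIidPl/fintype.subsetP => g _.
  by apply/stabP; rewrite linear0.
- move=> L K H [x LE] [y KE]; have [z zE] := stab_setI y x.
  by exists z; rewrite LE KE zE finset.setIA.
- move=> K H [x KE] [y HE]; apply/val_inj/eqP; rewrite finset.eqEsubset /=.
  by rewrite {1}KE subsetIl HE subsetIl.
- by move=> K H [x ->]; rewrite subsetIl.
- move=> K H g [x KE]; exists (rep_act U g x).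
  by rewrite stab_setJ /= KE conjIg.
- move=> K H L [x KE] LH; exists x => /=.
  rewrite KE finset.setIAC; congr (_ :&: _)%SET.
  exact/finset.setIidPr.
Qed.

End Stabilizers.

(** * Stabilizers in representations of abelian groups *)

(** A non-cyclic abelian group has [p]-rank at least two for some prime [p],
    hence contains two independent elements of order [p]. *)
Lemma noncyclic_abelian_witness (gT : finGroupType) (Q : {group gT}) :
  abelian Q -> ~~ cyclic Q -> exists p a b,
  [/\ prime p, a \in Q /\ b \in Q, (a ^+ p = 1 /\ b ^+ p = 1)%g,
      forall j, (0 < j < p)%N -> (b ^+ j != 1)%g &
      forall k, (a * b ^+ k != 1)%g].
Proof.
move=> abQ; rewrite abelian_rank1_cyclic // -ltnNge => rQ.
have [p p_pr rE] := rank_witness Q; rewrite rE in rQ.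
have [E /pnElemP[sEQ abelE logE]] := p_rank_geP rQ.
have [pE _ expE] := and3P abelE.
have cardE : #|E| = (p ^ 2)%N by rewrite (card_pgroup pE) logE.
have expEp x : x \in E -> (x ^+ p = 1)%g.
  by move=> xE; apply: (exponentP expE).
have p_gt1 := prime_gt1 p_pr.
have [b bE b1] : exists2 b, b \in E & b != 1%g.
  apply/trivgPn; rewrite trivg_card1 cardE.
  by rewrite neq_ltn (ltn_trans p_gt1) ?orbT // -{1}(expn1 p) ltn_exp2l.
have ob : #[b]%g = p by apply: nt_prime_order => //; exact: expEp.
have [a aE aNb] : exists2 a, a \in E & a \notin <[b]>%g.
  apply/subsetPn; apply/negP => /subset_leq_card.
  by rewrite cardE -orderE ob leqNgt -{1}(expn1 p) ltn_exp2l.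
exists p, a, b; split=> //.
- by split; apply: (fintype.subsetP sEQ).
- by split; apply: expEp.
- move=> j /andP[j0 jp]; rewrite -order_dvdn ob.
  by apply/negP => /dvdn_leq; rewrite j0 => /(_ isT); rewrite leqNgt jp.
- move=> k; apply: contra aNb => /eqP ab1.
  by rewrite -(groupMr _ (mem_cycle b k)) ab1 group1.
Qed.

Lemma noncocyclic_witness (gT : finGroupType) (S : {group gT}) :
  abelian [set: gT]%G -> ~~ cocyclic S -> exists p a b,
  [/\ prime p, a ^+ p \in S /\ b ^+ p \in S,
      forall j, (0 < j < p)%N -> b ^+ j \notin S &
      forall k, a * b ^+ k \notin S]%g.
Proof.
move=> abG; have sSG : S \subset [set: gT]%G by exact: finset.subsetT.
have nS x : x \in 'N(S)%g.
  by apply: (fintype.subsetP (sub_abelian_norm abG sSG)); rewrite inE.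
rewrite /cocyclic -(sub_abelian_normal _ abG) sSG /= => ncyc.
have abQ : abelian ([set: gT]%G / S)%g by exact: quotient_abelian.
have [p [a [b [p_pr [aQ bQ] [ap bp] bj abk]]]] :=
  noncyclic_abelian_witness abQ ncyc.
have [a' _ _ aE] := morphimP aQ; have [b' _ _ bE] := morphimP bQ.
have memS x : (x \in S) = (coset S x == 1%g).
  by apply/idP/eqP => [/coset_id|/(coset_idr (nS x))].
exists p, a', b'; split=> //.
- by rewrite !memS !morphX // -?aE -?bE ap bp eqxx.
- by move=> j /bj; rewrite memS morphX // -?bE.
- by move=> k; rewrite memS morphM ?morphX ?nS // -?aE -?bE.
Qed.

Section AbelianStabilizers.
Local Open Scope ring_scope.
Variables (R : realType) (gT : finGroupType) (U : orthogonal_rep R gT).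
Hypothesis abelianG : abelian [set: gT]%G.
Implicit Types (x y : U) (g h : gT).

Lemma mulgC_abelian g h : (g * h = h * g)%g.
Proof. by apply: (centsP abelianG); rewrite inE. Qed.

Lemma rep_actC g h x : rep_act U g (rep_act U h x) = rep_act U h (rep_act U g x).
Proof. by rewrite -!rep_actM mulgC_abelian. Qed.

Definition orbit_sum p h x := \sum_(j < p) rep_act U (h ^+ j)%g x.

Lemma orbit_sum_act p g h x :
  rep_act U g (orbit_sum p h x) = orbit_sum p h (rep_act U g x).
Proof.
by rewrite /orbit_sum linear_sum; apply: eq_bigr => j _; rewrite rep_actC.
Qed.

Lemma orbit_sum_fixed p h x :
  (h ^+ p)%g \in stab_set x -> h \in stab_set (orbit_sum p h x).
Proof.
case: p => [|p] /stabP hpx; apply/stabP.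
  by rewrite /orbit_sum big_ord0 linear0.
rewrite /orbit_sum linear_sum [RHS]big_ord_recl expg0 rep_act1.
rewrite big_ord_recr /= -rep_actM -expgS hpx addrC; congr (_ + _).
by apply: eq_bigr => j _; rewrite -rep_actM -expgS.
Qed.

Lemma stab_orbit_sum p h x : stab_set x \subset stab_set (orbit_sum p h x).
Proof.
by apply/fintype.subsetP => g /stabP gx; apply/stabP; rewrite orbit_sum_act gx.
Qed.

(** In the group ring,
    [\sum_k \sum_j (a b^k)^j = p + \sum_(0 < j) a^j \sum_k (b^j)^k]: a vector
    killed by the orbit sums of all [a b^k] and [b^j] is killed by [p]. *)
Lemma orbit_sums_eq0 p a b z : prime p ->
  (forall k, orbit_sum p (a * b ^+ k)%g z = 0) ->
  (forall j, (0 < j < p)%N -> orbit_sum p (b ^+ j)%g z = 0) -> z = 0.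
Proof.
case: p => // p p_pr ab0 b0.
have : \sum_(k < p.+1) orbit_sum p.+1 (a * b ^+ k)%g z = 0.
  by apply: big1 => k _; exact: ab0.
rewrite /orbit_sum exchange_big big_ord_recl /= [X in _ + X]big1 ?addr0.
  under eq_bigr do rewrite expg0 rep_act1.
  rewrite sumr_const card_ord => /eqP; rewrite -scaler_nat scaler_eq0.
  by rewrite pnatr_eq0 /= => /eqP.
move=> j _; rewrite /bump add1n.
transitivity (rep_act U (a ^+ j.+1)%g (orbit_sum p.+1 (b ^+ j.+1)%g z)).
  rewrite /orbit_sum [RHS]linear_sum; apply: eq_bigr => k _ /=.
  rewrite -rep_actM expgMn; first by rewrite -!expgM mulnC.
  exact: mulgC_abelian.
by rewrite b0 ?linear0 // !ltnS leq0n ltn_ord.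
Qed.

(** If the stabilizer of [x] is not cocyclic, two independent elements of
    order [p] in the quotient provide an orbit sum of [x] which is still moved
    by [g] and has a strictly larger stabilizer. *)
Lemma cocyclic_stab_separates g x : rep_act U g x <> x ->
  exists y, [/\ stab_set x \subset stab_set y, cocyclic (stab y) &
                rep_act U g y <> y].
Proof.
have [n] := ubnP (#|gT| - #|stab_set x|); elim: n x => // n IHn x xn gx.
have [coc|] := boolP (cocyclic (stab x)); first by exists x; split.
move=> /(noncocyclic_witness abelianG)[p [a [b [p_pr [ap bp] bj abk]]]].
have reduce h : (h ^+ p)%g \in stab_set x -> h \notin stab_set x ->
    rep_act U g (orbit_sum p h x) <> orbit_sum p h x ->
    exists y, [/\ stab_set x \subset stab_set y, cocyclic (stab y) &
                  rep_act U g y <> y].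
  move=> hp hx gN.
  have sN := stab_orbit_sum p h x.
  have ltN : (#|stab_set x| < #|stab_set (orbit_sum p h x)|)%N.
    apply: proper_card; rewrite properE sN; apply/subsetPn.
    by exists h => //; exact: orbit_sum_fixed.
  have [|y [sy cy gy]] := IHn _ _ gN.
    have := max_card (mem (stab_set (orbit_sum p h x))).
    move: xn ltN; rewrite !ltnS => xn ltN leN; apply: leq_trans xn.
    by rewrite ltn_sub2l // (leq_trans ltN).
  by exists y; split=> //; exact: fintype.subset_trans sN sy.
have [//|noN] := pselect (exists y, [/\ stab_set x \subset stab_set y,
  cocyclic (stab y) & rep_act U g y <> y]).
have Nz h : (h ^+ p)%g \in stab_set x -> h \notin stab_set x ->
    orbit_sum p h (rep_act U g x - x) = 0.
  move=> hp hx; have [Ng|Ng] := pselect (rep_act U g (orbit_sum p h x) = orbit_sum p h x).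
    rewrite /orbit_sum; under eq_bigr do rewrite linearB /=.
    by rewrite sumrB -/(orbit_sum p h _) -orbit_sum_act Ng subrr.
  by case: noN; exact: reduce hp hx Ng.
case: gx; apply/eqP; rewrite -subr_eq0; apply/eqP.
apply: (@orbit_sums_eq0 p a b) => // [k|j jp]; apply: Nz.
- rewrite expgMn; last exact: mulgC_abelian.
  by rewrite groupM // -expgM mulnC expgM groupX.
- exact: abk.
- by rewrite -expgM mulnC expgM groupX.
- exact: bj.
Qed.

(** Equivalently, a stabilizer is the intersection of the cocyclic stabilizers
    that contain it. *)
Lemma stab_cocyclicP x g :
  (forall y, stab_set x \subset stab_set y -> cocyclic (stab y) ->
     g \in stab_set y) -> g \in stab_set x.
Proof.
move=> gcoc; apply/stabP; have [//|gx] := pselect (rep_act U g x = x).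
have [y [sxy cy gy]] := cocyclic_stab_separates gx.
by case: gy; apply/stabP; exact: gcoc.
Qed.

End AbelianStabilizers.

(** * Transfer systems generated by stabilizers *)

(** Intersecting with one [A] at a time, each step is a restriction of
    [A -> G] and the steps compose. *)
Lemma transfer_bigcap (gT : finGroupType) (T : subgroup_relation gT)
    (transferT : is_transfer_system T) (s : seq {group gT}) :
  (forall A : {group gT}, A \in s -> T A [set: gT]%G) ->
  forall K H : {group gT}, K = (H :&: \bigcap_(A <- s) A)%SET :> {set gT} -> T K H.
Proof.
elim: s => [|A s IHs] Ts K H.
  rewrite big_nil finset.setIT => /val_inj ->; exact: transfer_refl.
rewrite big_cons finset.setIA => KE.
have TAH : T (A :&: H)%G H.
  apply: (transfer_restrict transferT); last exact: finset.subsetT.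
  by apply: Ts; rewrite mem_head.
apply: (transfer_trans transferT) TAH; apply: IHs => [B Bs|].
  by apply: Ts; rewrite inE Bs orbT.
by rewrite KE /= (finset.setIC A H).
Qed.

Section OrbitTransferGenerated.
Local Open Scope ring_scope.
Variables (R : realType) (gT : finGroupType) (U : orthogonal_rep R gT).

Lemma orbit_transfer_generatedP n (Hs : 'I_n -> {group gT}) :
  (forall i, exists x : U, stab_set x = Hs i) ->
  (forall (x : U) g, (forall i, stab_set x \subset Hs i -> g \in Hs i) ->
     g \in stab_set x) ->
  forall K H : {group gT}, orbit_transfer U K H <-> generated_transfer_system
    (fun A B => exists2 i, A = Hs i & B = [set: gT]%G) K H.
Proof.
move=> Hs_stab stab_Hs K H; split=> [[x KE] T transferT TH|]; last first.
  apply; first exact: orbit_transfer_system.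
  by move=> A B [i -> ->]; have [x xE] := Hs_stab i; exists x;
    rewrite xE finset.setTI.
pose s := [seq Hs i | i <- enum 'I_n & stab_set x \subset Hs i].
apply: (@transfer_bigcap _ _ transferT s) => [A /mapP[i _ ->]|].
  by apply: TH; exists i.
rewrite KE; congr (_ :&: _)%SET; apply/setP => g.
rewrite big_map big_filter big_enum_cond /=.
apply/idP/bigcapP => [gx i|gH]; first by move=> /fintype.subsetP; apply.
exact: stab_Hs.
Qed.

Lemma orbit_transfer_cocyclic : abelian [set: gT]%G ->
  exists (n : nat) (Hs : 'I_n -> {group gT}),
    (forall i, cocyclic (Hs i)) /\
    forall K H : {group gT}, orbit_transfer U K H <-> generated_transfer_system
      (fun A B => exists2 i, A = Hs i & B = [set: gT]%G) K H.
Proof.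
move=> abG.
pose S := [set A : {group gT} |
  cocyclic A && `[< exists x : U, stab_set x = A >]]%SET.
have S_P (i : 'I_#|S|) :
    cocyclic (enum_val i) /\ exists x : U, stab_set x = enum_val i.
  by have := enum_valP i; rewrite inE => /andP[? /asboolP].
exists #|S|, (fun i => enum_val i); split=> [i|]; first by have [] := S_P i.
apply: orbit_transfer_generatedP => [i|x g gH]; first by have [] := S_P i.
apply: (stab_cocyclicP abG) => y sxy cy.
have yS : stab y \in S by rewrite inE cy; apply/asboolP; exists y.
by have := gH (enum_rank_in yS (stab y)); rewrite enum_rankK_in //; apply.
Qed.

End OrbitTransferGenerated.

(** * Fixed points of the Steiner operad give orbits *)

Section SteinerToOrbit.
Local Open Scope ring_scope.
Local Open Scope classical_set_scope.
Variables (R : realType) (gT : finGroupType) (U : orthogonal_rep R gT).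
Variable V : fd_subrep U.

Lemma subrep0 : subrep_set V 0.
Proof.
have [n [b ->]] := subrep_fin_dim V; exists (fun=> 0).
by rewrite big1 // => i _; rewrite scale0r.
Qed.

Definition subrep_zero : V := SigSub (mem_set subrep0).

Lemma subrep_act_zero g : subrep_act g subrep_zero = subrep_zero.
Proof. by apply: val_inj; rewrite /= linear0. Qed.

(** The structure maps of the colimit are injective, because a self-map of [V]
    is recovered by evaluating its stabilization on [V]. *)
Lemma steiner_colim_eqP n (h h' : 'I_n -> self_map_path V) i t :
  steiner_colim_eq h h' -> h i t =1 h' i t.
Proof.
move=> [W [k [_ [VW hk] [_ hk']]]] v; apply: val_inj.
pose w : W := SigSub (mem_set (VW _ (set_valP v))).
have ort : forall u : V, rep_ip U (\val u) (\val w - \val v) = 0.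
  by move=> u; rewrite /= subrr linear0r.
have := hk i t v w ort; rewrite (hk' i t v w ort) /= => /addIr.
by move=> ->.
Qed.

End SteinerToOrbit.

Section SteinerToOrbitTransfer.
Local Open Scope ring_scope.
Variables (R : realType) (gT : finGroupType) (U : orthogonal_rep R gT).

(** The centres [h_i(0)(0)] of a fixed configuration form an embedded copy of
    the [H]-set [H / K], so the centre indexed by the coset [K] has
    stabilizer [K] in [H]. *)
Lemma steiner_transfer_orbit K H :
  steiner_transfer U K H -> orbit_transfer U K H.
Proof.
move=> [sKH [sigma [[e [e_inj e_im e_act]] [V [h [[h_path h_disj] h_fix]]]]]].
pose x i := \val (h i (I0 R) (subrep_zero V)).
have x_inj i j : x i = x j -> i = j.
  move=> xij; apply: (h_disj i j) => //.
  by exists (h i (I0 R) (subrep_zero V)); split; exists (subrep_zero V) => //;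
    apply: val_inj; rewrite [RHS]xij.
have x_act g i : g \in H -> rep_act U g (x i) = x (sigma g i).
  move=> gH; have gG : (g, sigma g) \in perm_rep_graph H sigma by exact: imset_f.
  have := steiner_colim_eqP (sigma g i) (I0 R) (h_fix _ gG) (subrep_zero V).
  by rewrite /steiner_act /= permK subrep_act_zero => /(congr1 val).
have : (1%g *: K)%g \in lcosets K H by apply/lcosetsP; exists 1%g.
rewrite -e_im => /imsetP[i _ eK].
exists (x i); apply/setP => g; rewrite inE.
have [gH /=|gH] := boolP (g \in H); last first.
  by apply/negbTE; apply: contra gH; exact: (fintype.subsetP sKH).
have -> : (g \in stab_set (x i)) = (sigma g i == i).
  rewrite inE x_act //; apply/eqP/eqP => [/x_inj|-> //] //.
rewrite -(inj_eq e_inj) e_act // -eK mul1g.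
by apply/idP/eqP => [/lcoset_id|<-]; last exact: lcoset_refl.
Qed.

End SteinerToOrbitTransfer.

(** * Radial shrinking of an orthogonal representation *)

Section Shrink.
Local Open Scope ring_scope.
Variables (R : realType) (gT : finGroupType) (U : orthogonal_rep R gT).
Implicit Types (x y v w : U) (s t c : R).

Lemma rep_ipC v w : rep_ip U v w = rep_ip U w v.
Proof. by rewrite hermC expr0 mul1r. Qed.

Lemma sqr_normD v w :
  `|v + w| ^+ 2 = `|v| ^+ 2 + `|w| ^+ 2 + 2 * rep_ip U v w.
Proof.
rewrite !rep_normE linearDl /= !linearDr /= (rep_ipC w v); ring.
Qed.

Lemma sqr_normB v w :
  `|v - w| ^+ 2 = `|v| ^+ 2 + `|w| ^+ 2 - 2 * rep_ip U v w.
Proof.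
have -> : rep_ip U v w = - rep_ip U v (- w) by rewrite linearNr opprK.
by rewrite sqr_normD normrN mulrN opprK.
Qed.

Lemma rep_ipZ (a b : R) v w :
  rep_ip U (a *: v) (b *: w) = a * b * rep_ip U v w.
Proof. by rewrite linearZl_LR /= linearZr_LR /= mulrA. Qed.

Lemma rep_ip_le v w : rep_ip U v w <= `|v| * `|w|.
Proof.
have : `|v + w| ^+ 2 <= (`|v| + `|w|) ^+ 2.
  by rewrite ler_pXn2r ?nnegrE ?addr_ge0 ?normr_ge0 // ler_normD.
rewrite sqr_normD sqrrD; lra.
Qed.

Lemma rep_act_norm g v : `|rep_act U g v| = `|v|.
Proof.
apply/eqP; rewrite -(eqrXn2 (n := 2)) ?normr_ge0 //.
by rewrite !rep_normE rep_act_ip.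
Qed.

(** For [0 < s], a homeomorphism onto the open ball of radius [1 / s], with
    inverse [unshrink]; for [s = 0], the identity. *)
Definition shrink s v : U := (1 + s * `|v|)^-1 *: v.

Definition unshrink s v : U := (1 - s * `|v|)^-1 *: v.

Lemma shrink_den_gt0 s v : 0 <= s -> 0 < 1 + s * `|v|.
Proof. by move=> s0; rewrite ltr_pwDl // mulr_ge0. Qed.

Lemma shrink0 v : shrink 0 v = v.
Proof. by rewrite /shrink mul0r addr0 invr1 scale1r. Qed.

Lemma norm_shrink s v : 0 <= s -> `|shrink s v| = `|v| / (1 + s * `|v|).
Proof.
by move=> s0; rewrite normrZ mulrC normfV gtr0_norm // shrink_den_gt0.
Qed.

Lemma shrink_bounded s v : 0 <= s -> s * `|shrink s v| < 1.
Proof.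
move=> s0; rewrite norm_shrink // mulrA ltr_pdivrMr ?shrink_den_gt0 //.
by rewrite mul1r ltrDr.
Qed.

Lemma shrinkK s : 0 <= s -> cancel (shrink s) (unshrink s).
Proof.
move=> s0 v; have d0 := shrink_den_gt0 v s0.
rewrite /unshrink norm_shrink // /shrink scalerA.
have -> : 1 - s * (`|v| / (1 + s * `|v|)) = (1 + s * `|v|)^-1.
  by field; rewrite gt_eqF.
by rewrite invrK divff ?gt_eqF // scale1r.
Qed.

Lemma shrink_act g s v : rep_act U g (shrink s v) = shrink s (rep_act U g v).
Proof. by rewrite /shrink linearZ /= rep_act_norm. Qed.

(** Split squared distances into a radial and an angular part,
    [|v - w|^2 = (|v| - |w|)^2 + 2 (|v||w| - <v, w>)]. With [a] and [b] the
    scaling factors at [v] and [w], shrinking multiplies the radial part by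
    [(a b)^2] and the angular part by [a b], and [a b <= 1]. *)
Lemma shrink_lipschitz s v w : 0 <= s ->
  `|shrink s v - shrink s w| <= `|v - w|.
Proof.
move=> s0; have dv := shrink_den_gt0 v s0; have dw := shrink_den_gt0 w s0.
rewrite -(ler_pXn2r (n := 2)) ?nnegrE ?normr_ge0 // !sqr_normB.
rewrite !norm_shrink // rep_ipZ.
set p := `|v|; set q := `|w|; set i := rep_ip U v w.
have ile : i <= p * q by exact: rep_ip_le.
set a := (1 + s * p)^-1; set b := (1 + s * q)^-1.
have a0 : 0 < a by rewrite invr_gt0. have b0 : 0 < b by rewrite invr_gt0.
have a1 : a <= 1.
  by rewrite invf_le1 // lerDl mulr_ge0 // normr_ge0.
have b1 : b <= 1.
  by rewrite invf_le1 // lerDl mulr_ge0 // normr_ge0.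
have ab0 : 0 <= a * b by rewrite mulr_ge0 // ltW.
have ab1 : a * b <= 1 by rewrite mulr_ile1 // ltW.
have rad : p * a - q * b = (a * b) * (p - q).
  rewrite /a /b /p /q; field; rewrite ?gt_eqF //.
have -> : (p * a) ^+ 2 + (q * b) ^+ 2 - 2 * (a * b * i) =
  (a * b) ^+ 2 * (p - q) ^+ 2 + 2 * (a * b) * (p * q - i).
  rewrite -exprMn -rad; ring.
have -> : p ^+ 2 + q ^+ 2 - 2 * i = 1 * (p - q) ^+ 2 + 2 * 1 * (p * q - i).
  ring.
apply: lerD; apply: ler_wpM2r; rewrite ?sqr_ge0 ?subr_ge0 //.
  by rewrite exprn_ile1.
by rewrite ler_pM2l.
Qed.

End Shrink.

Section ShrinkContinuity.
Local Open Scope ring_scope.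
Local Open Scope classical_set_scope.
Variables (R : realType) (gT : finGroupType) (U : orthogonal_rep R gT).

Lemma unshrink_continuous (s : R) (u : U) : 0 <= s -> s * `|u| < 1 ->
  {for u, continuous (unshrink s)}.
Proof.
move=> s0 su; apply: cvgZ; last exact: cvg_id.
apply: cvgV; first by rewrite subr_eq0 gt_eqF.
apply: cvgB; first exact: cvg_cst.
by apply: cvgM; [exact: cvg_cst | apply: cvg_norm; exact: cvg_id].
Qed.

Lemma shrink_cvg (X : topologicalType) (F : set_system X) (FF : Filter F)
    (f : X -> R) (k : X -> U) (s : R) (v : U) : 0 <= s ->
  f @ F --> s -> k @ F --> v -> (fun z => shrink (f z) (k z)) @ F --> shrink s v.
Proof.
move=> s0 fs kv; apply: cvgZ => //.
apply: cvgV; first by rewrite gt_eqF // shrink_den_gt0.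
apply: cvgD; first exact: cvg_cst.
by apply: cvgM => //; exact: cvg_norm.
Qed.

End ShrinkContinuity.

(** * Orbits give fixed points of the Steiner operad *)

Section SubrepClosure.
Local Open Scope ring_scope.
Variables (R : realType) (gT : finGroupType) (U : orthogonal_rep R gT).

Lemma subrepD (V : fd_subrep U) x y :
  subrep_set V x -> subrep_set V y -> subrep_set V (x + y).
Proof.
have [n [b ->]] := subrep_fin_dim V => -[c ->] [d ->].
exists (fun i => c i + d i); rewrite -big_split; apply: eq_bigr => i _.
by rewrite scalerDl.
Qed.

Lemma subrepZ (V : fd_subrep U) a x :
  subrep_set V x -> subrep_set V (a *: x).
Proof.
have [n [b ->]] := subrep_fin_dim V => -[c ->].
exists (fun i => a * c i); rewrite scaler_sumr; apply: eq_bigr => i _.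
by rewrite scalerA.
Qed.

Definition orbit_span (x : U) : set U :=
  [set y | exists c : 'I_#|gT| -> R,
     y = \sum_(i < #|gT|) c i *: rep_act U (enum_val i) x].

Lemma orbit_span_stable x g y :
  orbit_span x y -> orbit_span x (rep_act U g y).
Proof.
move=> [c ->].
pose f (h : gT) (i : 'I_#|gT|) : 'I_#|gT| := enum_rank (h * enum_val i)%g.
exists (fun i => c (f g^-1%g i)).
rewrite linear_sum (reindex (f g^-1%g)) /=.
  apply: eq_bigr => i _; rewrite linearZ /= -rep_actM.
  by rewrite enum_rankK mulKVg.
exists (f g) => i _; rewrite /f.
  by rewrite enum_rankK mulKVg enum_valK.
by rewrite enum_rankK mulKg enum_valK.
Qed.

Definition orbit_subrep (x : U) : fd_subrep U :=
  FdSubrep (ex_intro _ #|gT| (ex_intro _ (fun i => rep_act U (enum_val i) x)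
    (erefl (orbit_span x)))) (@orbit_span_stable x).

Lemma orbit_subrep_mem x g : subrep_set (orbit_subrep x) (rep_act U g x).
Proof.
exists (fun i => (i == enum_rank g)%:R).
rewrite (bigD1 (enum_rank g)) //= eqxx scale1r enum_rankK.
by rewrite big1 ?addr0 // => i /negbTE ->; rewrite scale0r.
Qed.

End SubrepClosure.

Section ShrinkPath.
Local Open Scope ring_scope.
Local Open Scope classical_set_scope.
Variables (R : realType) (gT : finGroupType) (U : orthogonal_rep R gT).
Variables (V : fd_subrep U) (x : V) (c : R).
Hypothesis c_ge0 : 0 <= c.

(** At [t = 1] the identity; at [t = 0] a map into the open ball of radius
    [1 / c] around [x], when [0 < c]. *)
Definition shrink_to (t : R) (v : U) : U :=
  (1 - t) *: \val x + shrink (c * (1 - t)) v.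

Lemma shrink_to_mem t (v : V) : subrep_set V (shrink_to t (\val v)).
Proof. by apply: subrepD; apply: subrepZ; exact: set_valP. Qed.

Definition shrink_path : self_map_path V :=
  fun t v => SigSub (mem_set (shrink_to_mem (\val t) v)).

Lemma shrink_scale_ge0 (t : unit_interval R) : 0 <= c * (1 - \val t).
Proof.
rewrite mulr_ge0 // subr_ge0.
by have := set_valP t; rewrite /unit_interval /= in_itv /= => /andP[].
Qed.

Lemma subrep_val_continuous : continuous (\val : V -> U).
Proof. exact: initial_continuous. Qed.

(** Continuity into the compact-open topology follows by currying. *)
Lemma shrink_path_joint_continuous :
  continuous (fun z : unit_interval R * V => shrink_path z.1 z.2).
Proof.
apply: (@continuous_comp_initial _ _ _ (set_val : V -> U)) => z.
have cvg1 : (fun z' : unit_interval R * V => \val z'.1) @ z --> (\val z.1 : R).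
  apply: (@continuous_comp _ _ _ fst (\val : unit_interval R -> R)).
    exact: cvg_fst.
  exact: initial_continuous.
have cvg2 : (fun z' : unit_interval R * V => \val z'.2) @ z --> (\val z.2 : U).
  apply: (@continuous_comp _ _ _ snd (\val : V -> U)).
    exact: cvg_snd.
  exact: initial_continuous.
have cvg1' : (fun z' : unit_interval R * V => 1 - \val z'.1) @ z --> (1 - \val z.1 : R).
  by apply: cvgB => //; exact: cvg_cst.
apply: cvgD.
  by apply: cvgZ => //; exact: cvg_cst.
apply: shrink_cvg => //; first exact: shrink_scale_ge0.
by apply: cvgM => //; exact: cvg_cst.
Qed.

Lemma shrink_path_embedding t : embedding (shrink_path t : V -> V).
Proof.
set s := c * (1 - \val t); have s0 : 0 <= s := shrink_scale_ge0 t.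
set p := (1 - \val t) *: \val x : U.
have valE v : \val (shrink_path t v) - p = shrink s (\val v).
  by rewrite /= /shrink_to addrAC subrr add0r.
have valK v : unshrink s (\val (shrink_path t v) - p) = \val v.
  by rewrite valE shrinkK.
split=> [v w vw|A]; first by apply: val_inj; rewrite -valK vw valK.
split; last first.
  move=> [B oB ->]; apply: open_comp oB => v _.
  exact: (continuous_curry shrink_path_joint_continuous).2.
move=> [W oW <-].
(* [unshrink] is continuous only inside the ball, so the ball is made part of
   the open set *)
pose D := [set u : U | s * `|u - p| < 1 /\ W (unshrink s (u - p))].
have oD : open D.
  rewrite openE => u [su Wu]; rewrite /interior.
  have cu : (fun u' : U => u' - p) @ u --> u - p.
    by apply: cvgB; [exact: cvg_id|exact: cvg_cst].
  apply: filterI.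
    have : (fun u' : U => s * `|u' - p|) @ u --> s * `|u - p|.
      by apply: cvgM; [exact: cvg_cst|apply: cvg_norm].
    by move/cvgr_lt; apply.
  have := cvg_comp _ _ cu (unshrink_continuous s0 su).
  by apply; exact: open_nbhs_nbhs.
exists ((\val : V -> U) @^-1` D).
  by apply: open_comp oD => v _; exact: subrep_val_continuous.
rewrite predeqE => v; rewrite /preimage /= /D /= -/(shrink_path t v).
split=> [Wv|[_]]; last by rewrite valK.
by split; [rewrite valE shrink_bounded|rewrite valK].
Qed.

Lemma shrink_path_steiner : is_steiner_path shrink_path.
Proof.
split.
- move=> t; split; first exact: shrink_path_embedding.
  move=> v w /=; rewrite /shrink_to opprD addrACA subrr add0r.
  exact: shrink_lipschitz (shrink_scale_ge0 t).
- exact: (continuous_curry_fun shrink_path_joint_continuous).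
- apply/funext => v; apply: val_inj.
  by rewrite /= /shrink_to subrr mulr0 scale0r add0r shrink0.
Qed.

Lemma shrink_path0_near v : c * `|\val (shrink_path (I0 R) v) - \val x| < 1.
Proof.
rewrite /= /shrink_to subr0 scale1r mulr1 addrAC subrr add0r.
exact: shrink_bounded.
Qed.

End ShrinkPath.

Lemma perm_rep_exists (gT : finGroupType) (K H : {group gT}) :
  exists sigma : gT -> {perm 'I_(#|H : K|%g)}, is_perm_rep K H sigma.
Proof.
pose e (i : 'I_(#|H : K|%g)) : {set gT} :=
  enum_val (cast_ord (esym (card_lcosets H K)) i).
have e_inj : injective e by move=> i j /enum_val_inj /cast_ord_inj.
have e_im : [set e i | i in [set: 'I_(#|H : K|%g)]]%SET = lcosets K H.
  apply/setP => A; apply/imsetP/idP => [[i _ ->]|AH]; first exact: enum_valP.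
  exists (cast_ord (card_lcosets H K) (enum_rank_in AH A)) => //.
  by rewrite /e cast_ordK enum_rankK_in.
have lc_act h i : h \in H -> exists j, e j = (h *: e i)%g.
  move=> hH; have : (h *: e i)%g \in lcosets K H.
    have : e i \in lcosets K H by rewrite -e_im imset_f.
    case/lcosetsP => k kH ->; apply/lcosetsP; exists (h * k)%g.
      by rewrite groupM.
    by rewrite -lcosetM.
  by rewrite -e_im => /imsetP[j _ ->]; exists j.
have permP h : exists p : {perm 'I_(#|H : K|%g)},
    h \in H -> forall i, e (p i) = (h *: e i)%g.
  have [hH|] := boolP (h \in H); last by exists 1%g.
  have [f fE] := choice (fun i => lc_act h i hH).
  have f_inj : injective f.
    move=> i j fij; apply: e_inj; apply: (@lcoset_inj _ h).
    by rewrite -!fE fij.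
  by exists (perm f_inj) => _ i; rewrite permE.
have [sigma sigmaE] := choice permP.
by exists sigma, e; split=> // h i hH; exact: sigmaE.
Qed.

Section OrbitToSteiner.
Local Open Scope ring_scope.
Local Open Scope classical_set_scope.
Variables (R : realType) (gT : finGroupType) (U : orthogonal_rep R gT).

(** The orthogonal complement of [V] in itself is zero, so [h] stabilizes to
    [h] and equations that hold at the stage [V] hold in the colimit. *)
Lemma steiner_colim_refl (V : fd_subrep U) n (h : 'I_n -> self_map_path V) :
  steiner_operad V n h -> steiner_colim_eq h h.
Proof.
have stab_h : steiner_stabilizes_to h h.
  split=> // i t v w ort.
  have /eqP := ort (SigSub (mem_set
    (subrepD (set_valP w) (subrepZ (-1) (set_valP v))))).
  rewrite /= scaleN1r -rep_normE sqrf_eq0 normr_eq0 subr_eq0.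
  move=> /eqP/val_inj ->.
  by rewrite subrr addr0.
by move=> h_op; exists V, h; split.
Qed.

(** When [0 < c], the conclusion says that the balls of radius [1 / c] around
    the [x i] are pairwise disjoint. *)
Lemma separating_scale n (x : 'I_n -> U) : injective x ->
  exists2 c : R, 0 <= c & forall i j, i != j -> 2 <= c * `|x i - x j|.
Proof.
move=> x_inj; pose d i j := 2 / `|x i - x j|.
have d0 i j : 0 <= d i j by rewrite divr_ge0 // normr_ge0.
exists (\sum_i \sum_j d i j) => [|i j ij].
  by apply: sumr_ge0 => i _; apply: sumr_ge0 => j _.
have xij : 0 < `|x i - x j|.
  by rewrite normr_gt0 subr_eq0; apply: contra ij => /eqP/x_inj ->.
(* the sum of all [2 / |x_i - x_j|] bounds each of them *)
rewrite -ler_pdivrMr // (bigD1 i) //= (bigD1 j) //= -addrA lerDl.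
by apply: addr_ge0; apply: sumr_ge0 => k _ //; apply: sumr_ge0 => l _.
Qed.

(** An orbit [H / K] inside [U] spans a finite dimensional [V]; shrinking [V]
    to small disjoint balls around the points of the orbit is a configuration
    on which [H] acts by permuting the balls. *)
Lemma orbit_transfer_steiner K H :
  orbit_transfer U K H -> steiner_transfer U K H.
Proof.
move=> [x KE].
have sKH : K \subset H by rewrite KE subsetIl.
split=> //; have [sigma sigma_rep] := perm_rep_exists K H.
exists sigma; split=> //; have [e [e_inj e_im e_act]] := sigma_rep.
pose V := orbit_subrep x.
pose r i := repr (e i).
pose y i : V := SigSub (mem_set (orbit_subrep_mem x (r i))).
have stabK g k : k \in K -> rep_act U (g * k)%g x = rep_act U g x.
  by rewrite KE inE => /andP[_ /stabP kx]; rewrite rep_actM kx.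
have eE i : exists2 g, g \in H & e i = (g *: K)%g.
  by apply/lcosetsP; rewrite -e_im imset_f.
have act_coset i g : g \in e i -> rep_act U g x = \val (y i).
  rewrite /= /r; have [k kH ->] := eE i => gk.
  have : repr (k *: K)%g \in (k *: K)%g by exact: mem_repr gk.
  move: gk => /lcosetP[a aK ->] /lcosetP[b bK ->].
  by rewrite !stabK.
have r_mem i : r i \in e i.
  by have [k kH eik] := eE i; apply: (mem_repr k); rewrite eik lcoset_refl.
have rH i : r i \in H.
  have [k kH eik] := eE i; have := r_mem i; rewrite eik => /lcosetP[a aK ->].
  by rewrite groupM // (fintype.subsetP sKH).
have y_inj : injective (fun i => \val (y i) : U).
  move=> i j yij; have : (r i \in e j).
    have [k kH ejk] := eE j; have := r_mem j.
    rewrite ejk => /lcosetP[a aK rjE]; rewrite mem_lcoset KE inE.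
    rewrite groupM ?groupV //=; apply/stabP; rewrite rep_actM.
    by rewrite [rep_act U (r i) x]yij /= rjE stabK // rep_actVK.
  have := r_mem i.
  have [k kH eik] := eE i; have [l lH ejl] := eE j.
  rewrite eik ejl => /lcoset_eqP ikE /lcoset_eqP ilE.
  by apply: e_inj; rewrite eik ejl -ikE ilE.
have y_act g i : g \in H -> rep_act U g (\val (y i)) = \val (y (sigma g i)).
  move=> gH; rewrite -(act_coset (sigma g i) (g * r i)%g) ?rep_actM //.
  by rewrite e_act // mem_lcoset mulKg.
have [c c0 cP] := separating_scale y_inj.
pose h i := shrink_path (y i) c.
have h_op : steiner_operad V _ h.
  split=> [i|]; first exact: shrink_path_steiner.
  move=> i j _ _ [v [[u _ uv] [w _ wv]]]; apply/eqP/negPn/negP => ij.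
  have := cP i j ij; apply/negP; rewrite -ltNge.
  have near_i := shrink_path0_near (y i) c0 u.
  have near_j := shrink_path0_near (y j) c0 w.
  rewrite -/(h i) uv in near_i; rewrite -/(h j) wv in near_j.
  apply: (@le_lt_trans _ _ (c * `|\val v - \val (y i)| + c * `|\val v - \val (y j)|)).
    rewrite -mulrDr ler_wpM2l // (distrC (\val v : U)).
    exact: ler_distD.
  lra.
exists V, h; split=> // _ /imsetP[g gH ->].
suff -> : steiner_act (g, sigma g) h = h by exact: steiner_colim_refl.
apply/funext => i; apply/funext => t; apply/funext => v; apply: val_inj.
rewrite /= /shrink_to linearD linearZ /= shrink_act rep_actKV.
have /= -> := y_act g ((sigma g)^-1%g i) gH.
by rewrite permKV.
Qed.

Lemma steiner_transferE K H :
  steiner_transfer U K H <-> orbit_transfer U K H.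
Proof. by split=> [/steiner_transfer_orbit|/orbit_transfer_steiner]. Qed.

End OrbitToSteiner.

(** * Characters into the rotation group of the plane *)

Section PlanarCharacters.
Local Open Scope ring_scope.
Variables (R : realType) (gT : finGroupType).

(** A homomorphism to the rotation group of the plane, by matrix entries. *)
Record planar_character := PlanarCharacter {
  chi_cos : gT -> R;
  chi_sin : gT -> R;
  chi_cosM : forall g h,
    chi_cos (g * h)%g = chi_cos g * chi_cos h - chi_sin g * chi_sin h;
  chi_sinM : forall g h,
    chi_sin (g * h)%g = chi_sin g * chi_cos h + chi_cos g * chi_sin h;
  chi_norm : forall g, chi_cos g ^+ 2 + chi_sin g ^+ 2 = 1;
  chi_cos1 : chi_cos 1%g = 1 }.

Lemma chi_sin_eq0 (chi : planar_character) g :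
  chi_cos chi g = 1 -> chi_sin chi g = 0.
Proof.
move=> c1; have := chi_norm chi g; rewrite c1 expr1n => /eqP.
by rewrite -subr_eq0 addrAC subrr add0r sqrf_eq0 => /eqP.
Qed.

Definition trivial_character : planar_character.
Proof.
by exists (fun=> 1) (fun=> 0) => *; rewrite ?mulr0 ?mul0r ?mulr1 ?subr0 ?addr0
  ?expr1n ?expr0n ?addr0.
Defined.

Lemma cos_turns (m i j : nat) : (0 < m)%N -> i = j %[mod m] ->
  cos (pi *+ 2 / m%:R * i%:R) = cos (pi *+ 2 / m%:R * j%:R) :> R /\
  sin (pi *+ 2 / m%:R * i%:R) = sin (pi *+ 2 / m%:R * j%:R) :> R.
Proof.
move=> m0 ij.
have red k : cos (pi *+ 2 / m%:R * k%:R) = cos (pi *+ 2 / m%:R * (k %% m)%:R) :> R /\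
    sin (pi *+ 2 / m%:R * k%:R) = sin (pi *+ 2 / m%:R * (k %% m)%:R) :> R.
  have -> : pi *+ 2 / m%:R * k%:R =
      pi *+ 2 / m%:R * (k %% m)%:R + pi *+ 2 *+ (k %/ m) :> R.
    rewrite {1}(divn_eq k m) natrD natrM -[in RHS]mulr_natr; field.
    by rewrite pnatr_eq0 -lt0n.
  by rewrite (periodicn (@cosD2pi R)) (periodicn (@sinD2pi R)).
by have [-> ->] := red i; have [-> ->] := red j; rewrite ij.
Qed.

Lemma cos_turn_eq1 (m i : nat) : (0 < m)%N ->
  cos (pi *+ 2 / m%:R * i%:R) = 1 :> R -> (m %| i)%N.
Proof.
move=> m0; have [-> _] := cos_turns m0 (esym (modn_mod i m)).
have im := ltn_pmod i m0; rewrite /dvdn; move: (i %% m)%N im => {i} i im.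
case: i im => // i im ci.
pose a : R := pi / m%:R * i.+1%:R.
have aE : pi *+ 2 / m%:R * i.+1%:R = a *+ 2.
  by rewrite /a -!mulrA mulrnAl.
have m_gt0 : 0 < m%:R :> R by rewrite ltr0n.
have a0 : 0 < a by rewrite !mulr_gt0 ?invr_gt0 ?pi_gt0 ?ltr0n.
have api : a < pi.
  by rewrite /a -mulrA gtr_pMr ?pi_gt0 // mulrC ltr_pdivrMr // mul1r ltr_nat.
have sa : 0 < sin a by apply: sin_gt0_pi; rewrite a0 api.
have ss : 0 < sin a * sin a by rewrite mulr_gt0.
(* [cos (2 a) = 1 - 2 sin^2 a] is less than [1] *)
have := cos2Dsin2 a; move: ci; rewrite aE mulr2n cosD !expr2; lra.
Qed.

(** The quotient by a cocyclic subgroup is cyclic of some order [m]; send a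
    generator to the rotation by [2 pi / m]. *)
Lemma cocyclic_character (H : {group gT}) : cocyclic H ->
  exists chi : planar_character, forall g, chi_cos chi g = 1 <-> g \in H.
Proof.
move=> /andP[nHG /cyclicP[a aE]].
have nH x : x \in 'N(H)%g.
  by apply: (fintype.subsetP (normal_norm nHG)); rewrite inE.
have logP g : exists k, coset H g = (a ^+ k)%g.
  by apply/cycleP; rewrite -aE; apply: mem_quotient; rewrite inE.
have [log logE] := choice logP.
pose m := #[a]%g; have m0 : (0 < m)%N := order_gt0 a.
have logM g h : log (g * h)%g = (log g + log h)%N %[mod m].
  by apply/eqP; rewrite -eq_expg_mod_order expgD -!logE morphM.
have log_mem g : (g \in H) = (m %| log g)%N.
  rewrite order_dvdn -logE; apply/idP/eqP => [/coset_id|] //.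
  exact: coset_idr.
pose t k : R := pi *+ 2 / m%:R * k%:R.
have tD i j : t (i + j)%N = t i + t j by rewrite /t natrD mulrDr.
have cM g h : cos (t (log (g * h)%g)) =
    cos (t (log g)) * cos (t (log h)) - sin (t (log g)) * sin (t (log h)).
  by rewrite -cosD -tD; have [] := cos_turns m0 (logM g h).
have sM g h : sin (t (log (g * h)%g)) =
    sin (t (log g)) * cos (t (log h)) + cos (t (log g)) * sin (t (log h)).
  by rewrite -sinD -tD; have [] := cos_turns m0 (logM g h).
have cE g : cos (t (log g)) = 1 <-> g \in H.
  rewrite log_mem; split; first exact: cos_turn_eq1.
  move=> mg; have mg0 : log g = 0 %[mod m] by rewrite (eqP mg) mod0n.
  by have [+ _] := cos_turns m0 mg0; rewrite /t => ->; rewrite mulr0 cos0.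
by exists (PlanarCharacter cM sM (fun g => cos2Dsin2 _) ((cE 1%g).2 (group1 H))).
Qed.

End PlanarCharacters.

(** * A universe with prescribed characters *)

Section PlaneSum.
Local Open Scope ring_scope.
Variable R : realType.

(** The sum of countably many planes, as finitely supported real sequences: the
    [k]-th plane has coordinates [2k] and [2k + 1]. *)
Definition plane_sum := {poly R}.

HB.instance Definition _ := GRing.Lmodule.copy plane_sum {poly R}.

Implicit Types p q u v : plane_sum.

Definition coord p (i : nat) : R := (p : {poly R})`_i.
Definition support_size p : nat := size (p : {poly R}).

Lemma coordD p q i : coord (p + q) i = coord p i + coord q i.
Proof. exact: coefD. Qed.

Lemma coordZ a p i : coord (a *: p) i = a * coord p i.
Proof. exact: coefZ. Qed.

Lemma coord0 i : coord 0 i = 0.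
Proof. exact: coef0. Qed.

Lemma coord_sum n (f : 'I_n -> plane_sum) i :
  coord (\sum_(j < n) f j) i = \sum_(j < n) coord (f j) i.
Proof. exact: coef_sum. Qed.

Lemma coord_default p i : (support_size p <= i)%N -> coord p i = 0.
Proof. exact: nth_default. Qed.

Lemma coordP p q : (forall k, coord p k.*2 = coord q k.*2 /\
  coord p k.*2.+1 = coord q k.*2.+1) -> p = q.
Proof.
move=> pq; apply/polyP => i; have [e o] := pq i./2.
suff : coord p (odd i + i./2.*2) = coord q (odd i + i./2.*2).
  by rewrite odd_double_half.
by case: (odd i).
Qed.

(** Summing over [support_size p] planes suffices, as [p] vanishes on the planes
    of larger index. *)
Definition plane_dot p q : R := \sum_(k < support_size p)
  (coord p k.*2 * coord q k.*2 + coord p k.*2.+1 * coord q k.*2.+1).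

Lemma plane_dotE n p q : (support_size p <= n)%N -> plane_dot p q =
  \sum_(k < n) (coord p k.*2 * coord q k.*2 + coord p k.*2.+1 * coord q k.*2.+1).
Proof.
move=> pn; rewrite /plane_dot (big_ord_widen_cond n xpredT (fun k =>
  coord p k.*2 * coord q k.*2 + coord p k.*2.+1 * coord q k.*2.+1)) //=.
rewrite [RHS](bigID (fun k : 'I_n => (k < support_size p)%N)) /=.
rewrite [X in _ = _ + X]big1 ?addr0 // => k; rewrite -leqNgt => pk.
have pk2 : (support_size p <= k.*2)%N.
  by rewrite (leq_trans pk) // -addnn leq_addr.
by rewrite !(@coord_default p) ?mul0r ?addr0 // leqW.
Qed.

Lemma plane_dotC p q : plane_dot p q = plane_dot q p.
Proof.
set n := maxn (support_size p) (support_size q).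
rewrite (@plane_dotE n p) ?leq_maxl // (@plane_dotE n q) ?leq_maxr //.
by apply: eq_bigr => k _; rewrite mulrC [X in _ + X]mulrC.
Qed.

Lemma plane_dotDr p u v : plane_dot p (u + v) = plane_dot p u + plane_dot p v.
Proof.
rewrite /plane_dot -big_split; apply: eq_bigr => k _ /=.
rewrite !coordD; ring.
Qed.

Lemma plane_dotZr a p u : plane_dot p (a *: u) = a * plane_dot p u.
Proof.
rewrite /plane_dot mulr_sumr; apply: eq_bigr => k _ /=.
rewrite !coordZ; ring.
Qed.

Lemma plane_dotBr p : zmod_morphism (plane_dot p).
Proof. by move=> u v; rewrite plane_dotDr -scaleN1r plane_dotZr mulN1r. Qed.

Lemma plane_dot_gt0 p : p != 0 -> 0 < plane_dot p p.
Proof.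
move=> p0; pose sq k := coord p k.*2 ^+ 2 + coord p k.*2.+1 ^+ 2.
have sq0 k : 0 <= sq k by rewrite addr_ge0 // sqr_ge0.
have dotE : plane_dot p p = \sum_(k < support_size p) sq k.
  by apply: eq_bigr => k _; rewrite /sq !expr2.
rewrite dotE lt_neqAle sumr_ge0 // andbT eq_sym.
apply: contra p0 => /eqP; move/psumr_eq0P => sq_eq0; apply/eqP/coordP => k.
rewrite !coord0; have [pk|pk] := leqP (support_size p) k.
  have pk2 : (support_size p <= k.*2)%N.
    by rewrite (leq_trans pk) // -addnn leq_addr.
  by rewrite !coord_default // ltnW.
have /eqP : sq (Ordinal pk) = 0 by apply: sq_eq0.
by rewrite paddr_eq0 ?sqr_ge0 // !sqrf_eq0 => /andP[/eqP -> /eqP ->].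
Qed.

Lemma plane_dotBl q : zmod_morphism (plane_dot ^~ q).
Proof. by move=> u v; rewrite ![plane_dot _ q]plane_dotC plane_dotBr. Qed.

Lemma plane_dot_scalel q : scalable_for *%R (plane_dot ^~ q).
Proof. by move=> a u; rewrite ![plane_dot _ q]plane_dotC plane_dotZr. Qed.

Lemma plane_dot_scaler p : scalable_for (idfun \; *%R) (plane_dot p).
Proof. by move=> a u; rewrite plane_dotZr. Qed.

HB.instance Definition _ := isBilinear.Build R plane_sum plane_sum R
  *%R (idfun \; *%R) plane_dot plane_dotBl plane_dotBr
  plane_dot_scalel plane_dot_scaler.

Lemma plane_dot_herm p q : plane_dot p q = (-1) ^+ false * idfun (plane_dot q p).
Proof. by rewrite expr0 mul1r plane_dotC. Qed.

HB.instance Definition _ :=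
  isHermitianSesquilinear.Build R plane_sum false idfun plane_dot plane_dot_herm.

HB.instance Definition _ :=
  isDotProduct.Build R plane_sum plane_dot plane_dot_gt0.

Definition plane_norm p : R := Num.sqrt (plane_dot p p).

Lemma plane_dot_ge0 p : 0 <= plane_dot p p.
Proof.
have [->|p0] := eqVneq p 0; last exact/ltW/plane_dot_gt0.
by rewrite -(scale0r (0 : plane_sum)) plane_dotZr mul0r.
Qed.

Lemma sqr_plane_norm p : plane_norm p ^+ 2 = plane_dot p p.
Proof. by rewrite sqr_sqrtr // plane_dot_ge0. Qed.

Lemma plane_normZ a p : plane_norm (a *: p) = `|a| * plane_norm p.
Proof.
rewrite /plane_norm plane_dotZr plane_dotC plane_dotZr mulrA -expr2.
by rewrite sqrtrM ?sqr_ge0 // sqrtr_sqr.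
Qed.

Lemma plane_norm_eq0 p : plane_norm p = 0 -> p = 0.
Proof.
move=> p0; apply/eqP; have [//|pn0] := boolP (p == 0).
by have := plane_dot_gt0 pn0; rewrite -sqr_plane_norm p0 expr0n ltxx.
Qed.

(** Cauchy-Schwarz, from [0 <= |r p - s q|^2] with [r = |q|] and [s = |p|]. *)
Lemma plane_dot_le p q : plane_dot p q <= plane_norm p * plane_norm q.
Proof.
have [->|p0] := eqVneq p 0.
  rewrite plane_dotC -(scale0r (0 : plane_sum)) plane_dotZr mul0r.
  by rewrite mulr_ge0 // sqrtr_ge0.
have [->|q0] := eqVneq q 0.
  rewrite -(scale0r (0 : plane_sum)) plane_dotZr mul0r.
  by rewrite mulr_ge0 // sqrtr_ge0.
set s := plane_norm p; set r := plane_norm q.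
have s0 : 0 < s by rewrite sqrtr_gt0 plane_dot_gt0.
have r0 : 0 < r by rewrite sqrtr_gt0 plane_dot_gt0.
have := plane_dot_ge0 (r *: p + (- s) *: q).
have -> : plane_dot (r *: p + (- s) *: q) (r *: p + (- s) *: q) =
    2 * (r * s) * (s * r - plane_dot p q).
  rewrite plane_dotDr !plane_dotZr ![plane_dot (_ + _) _]plane_dotC.
  rewrite !plane_dotDr !plane_dotZr (plane_dotC q p) -!sqr_plane_norm.
  rewrite -/s -/r; ring.
by rewrite pmulr_rge0 ?subr_ge0 // !mulr_gt0.
Qed.

Lemma plane_normD p q : plane_norm (p + q) <= plane_norm p + plane_norm q.
Proof.
rewrite -(ler_pXn2r (n := 2)) ?nnegrE ?addr_ge0 ?sqrtr_ge0 //.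
rewrite sqr_plane_norm plane_dotDr ![plane_dot (p + q) _]plane_dotC !plane_dotDr.
rewrite sqrrD !sqr_plane_norm (plane_dotC q p).
have := plane_dot_le p q; lra.
Qed.

HB.instance Definition _ := Lmodule_isNormed.Build R plane_sum
  plane_normD plane_normZ plane_norm_eq0.

End PlaneSum.

Section RotationRep.
Local Open Scope ring_scope.
Variables (R : realType) (gT : finGroupType).
Variables (chi : nat -> planar_character R gT).
Implicit Types (p q : plane_sum R).

Definition rotate (g : gT) p : plane_sum R := \poly_(i < (support_size p).+1)
  (if odd i
   then chi_sin (chi i./2) g * coord p i.-1 + chi_cos (chi i./2) g * coord p i
   else chi_cos (chi i./2) g * coord p i - chi_sin (chi i./2) g * coord p i.+1).

Lemma coord_rotate_even g p k : coord (rotate g p) k.*2 =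
  chi_cos (chi k) g * coord p k.*2 - chi_sin (chi k) g * coord p k.*2.+1.
Proof.
rewrite /coord coef_poly odd_double doubleK -/(coord p _) -/(coord p _).
case: ltnP => // pk; rewrite !coord_default ?mulr0 ?subr0 // ltnW //.
exact: ltnW.
Qed.

Lemma coord_rotate_odd g p k : coord (rotate g p) k.*2.+1 =
  chi_sin (chi k) g * coord p k.*2 + chi_cos (chi k) g * coord p k.*2.+1.
Proof.
rewrite /coord coef_poly /= odd_double /= uphalf_double -/(coord p _).
by rewrite -/(coord p _) ltnS; case: ltnP => // pk;
  rewrite !coord_default ?mulr0 ?addr0 // ltnW.
Qed.

Definition coord_rotate := (coord_rotate_even, coord_rotate_odd).

Lemma rotate_linear g : linear (rotate g).
Proof.
move=> a p q; apply: coordP => k; rewrite !coord_rotate !coordD !coordZ.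
rewrite !coord_rotate; split; ring.
Qed.

HB.instance Definition _ g :=
  GRing.isLinear.Build R (plane_sum R) (plane_sum R) *:%R (rotate g)
    (rotate_linear g).

Lemma rotate1 p : rotate 1%g p = p.
Proof.
apply: coordP => k; rewrite !coord_rotate chi_cos1 chi_sin_eq0 ?chi_cos1 //.
split; ring.
Qed.

Lemma rotateM g h p : rotate (g * h)%g p = rotate g (rotate h p).
Proof.
apply: coordP => k; rewrite !coord_rotate chi_cosM chi_sinM; split; ring.
Qed.

Lemma rotate_dot g p q : plane_dot (rotate g p) (rotate g q) = plane_dot p q.
Proof.
set n := maxn (support_size (rotate g p)) (support_size p).
rewrite (@plane_dotE _ n) ?leq_maxl // (@plane_dotE _ n p) ?leq_maxr //.
apply: eq_bigr => k _; rewrite !coord_rotate.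
set c := chi_cos _ _; set s := chi_sin _ _.
have cs : c ^+ 2 + s ^+ 2 = 1 by exact: chi_norm.
transitivity ((c ^+ 2 + s ^+ 2) *
  (coord p k.*2 * coord q k.*2 + coord p k.*2.+1 * coord q k.*2.+1)).
  ring.
by rewrite cs mul1r.
Qed.

Lemma plane_normE p : `|p| ^+ 2 = plane_dot p p.
Proof. exact: sqr_plane_norm. Qed.

Definition rotation_rep : orthogonal_rep R gT :=
  @OrthogonalRep R gT (plane_sum R) (@plane_dot R) plane_normE
    (fun g => rotate g : {linear plane_sum R -> plane_sum R})
    rotate1 rotateM rotate_dot.

End RotationRep.

Section RotationUniverse.
Local Open Scope ring_scope.
Local Open Scope classical_set_scope.
Variables (R : realType) (gT : finGroupType).
Variables (chi : nat -> planar_character R gT).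
Implicit Types (p q : plane_sum R).

Definition unit_vector (i : nat) : plane_sum R := 'X^i.

Lemma coord_unit_vector i j : coord (unit_vector i) j = (j == i)%:R.
Proof. exact: coefXn. Qed.

Lemma plane_sum_dim : countably_infinite_dim (plane_sum R).
Proof.
exists unit_vector; split=> [n c cX0 i|p].
  have := coord0 R i; rewrite -cX0 coord_sum (bigD1 i) //= big1 => [|j ji].
    by rewrite addr0 coordZ coord_unit_vector eqxx mulr1.
  by rewrite coordZ coord_unit_vector val_eqE eq_sym (negbTE ji) mulr0.
exists (support_size p), (fun i => coord p i).
rewrite -[LHS]coefK poly_def; apply: eq_bigr => i _.
by rewrite /coord /unit_vector.
Qed.

(** A nontrivial rotation of the plane fixes only the origin. *)
Lemma rotate_fixedP g p : rotate chi g p = p <->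
  (forall k, chi_cos (chi k) g = 1 \/
             (coord p k.*2 = 0 /\ coord p k.*2.+1 = 0)).
Proof.
split=> [gp k|fixp]; last first.
  apply: coordP => k; rewrite !coord_rotate; have [c1|[-> ->]] := fixp k.
    by rewrite c1 chi_sin_eq0 // !mul0r !mul1r subr0 add0r.
  by rewrite !mulr0 subr0 addr0.
have := coord_rotate_even chi g p k; have := coord_rotate_odd chi g p k.
rewrite gp; have := chi_norm (chi k) g.
set c := chi_cos _ _; set s := chi_sin _ _.
set a := coord p k.*2; set b := coord p k.*2.+1 => cs bE aE.
have [c1|c1] := eqVneq c 1; [by left|right].
(* [c^2 + s^2 = 1] makes the determinant of [rotation - id] equal to
   [2 (1 - c)] *)
have det : (2 * (1 - c)) != 0 by rewrite mulf_neq0 ?pnatr_eq0 ?subr_eq0 // eq_sym.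
have detE : 2 * (1 - c) = (1 - c) ^+ 2 + s ^+ 2.
  rewrite -[s ^+ 2](addKr (c ^+ 2)) cs; ring.
have a0 : (1 - c) * a + s * b = 0 by rewrite mulrBl mul1r {1}aE; ring.
have b0 : (1 - c) * b - s * a = 0 by rewrite mulrBl mul1r {1}bE; ring.
split; apply: (mulfI det); rewrite mulr0 detE.
  transitivity ((1 - c) * ((1 - c) * a + s * b) - s * ((1 - c) * b - s * a)).
    ring.
  by rewrite a0 b0 !mulr0 subr0.
transitivity (s * ((1 - c) * a + s * b) + (1 - c) * ((1 - c) * b - s * a)).
  ring.
by rewrite a0 b0 !mulr0 addr0.
Qed.

(** Translation by [j] planes. *)
Definition shift (j : nat) p : plane_sum R := (p : {poly R}) * 'X^(j.*2).

Lemma coord_shift j p k b : (b < 2)%N ->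
  coord (shift j p) (b + k.*2)%N =
  if (k < j)%N then 0 else coord p (b + (k - j).*2)%N.
Proof.
move=> b2; rewrite /coord /shift coefMXn.
have -> : (b + k.*2 < j.*2)%N = (k < j)%N by lia.
by case: ltnP => // jk; congr (_`_ _); lia.
Qed.

Lemma coord_shift_even j p k : coord (shift j p) k.*2 =
  if (k < j)%N then 0 else coord p (k - j).*2.
Proof. exact: (@coord_shift j p k 0). Qed.

Lemma coord_shift_odd j p k : coord (shift j p) k.*2.+1 =
  if (k < j)%N then 0 else coord p (k - j).*2.+1.
Proof. exact: (@coord_shift j p k 1). Qed.

Lemma shift_linear j a p q : shift j (a *: p + q) = a *: shift j p + shift j q.
Proof. by rewrite /shift mulrDl -scalerAl. Qed.

Lemma shift_dot j p q : plane_dot (shift j p) (shift j q) = plane_dot p q.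
Proof.
set n := support_size p + support_size (shift j p).
rewrite (@plane_dotE _ (j + n)); last by rewrite /n addnA leq_addl.
rewrite (@plane_dotE _ n p) ?leq_addr // big_split_ord /= big1 ?add0r.
  apply: eq_bigr => k _; rewrite !coord_shift_even !coord_shift_odd.
  by rewrite ltnNge leq_addr /= addKn.
move=> k _; rewrite !coord_shift_even !coord_shift_odd ltn_ord.
by rewrite !mul0r addr0.
Qed.

Lemma shift_orthogonal i j n p q : (support_size p <= n)%N ->
  (i + n <= j)%N -> plane_dot (shift i p) (shift j q) = 0.
Proof.
move=> pn inj; rewrite /plane_dot big1 // => k _.
rewrite !coord_shift_even !coord_shift_odd.
have [kj|jk] := ltnP k j; first by rewrite !mulr0 addr0.
have ik : (i <= k)%N by lia.
by rewrite ltnNge ik /= !(@coord_default _ p) ?mul0r ?addr0 //; lia.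
Qed.

Section Periodic.
Variable d : nat.
Hypothesis d_gt0 : (0 < d)%N.
Hypothesis chi_periodic : forall k, chi (k + d)%N = chi k.

Lemma chi_periodicM k m : chi (k + m * d)%N = chi k.
Proof.
by elim: m => [|m IHm]; rewrite ?addn0 // mulSn [(d + _)%N]addnC addnA
  chi_periodic.
Qed.

Lemma shift_rotate m g p :
  shift (m * d) (rotate chi g p) = rotate chi g (shift (m * d) p).
Proof.
apply: coordP => k; rewrite !coord_shift_even !coord_shift_odd !coord_rotate.
rewrite !coord_shift_even !coord_shift_odd.
have [kmd|mdk] := ltnP k (m * d); first by rewrite !mulr0 subr0 addr0.
by have -> : chi k = chi (k - m * d)%N by rewrite -{1}(subnK mdk) chi_periodicM.
Qed.

(** A finite dimensional subrepresentation lives on the first [n] planes;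
    translating it by multiples of [n * d] gives orthogonal copies of it. *)
Lemma rotation_universe : (exists k, forall g, chi_cos (chi k) g = 1) ->
  is_universe (rotation_rep chi).
Proof.
move=> [k0 k0_triv]; split; first exact: plane_sum_dim.
- move=> V; have [r [b VE]] := subrep_fin_dim V.
  have [n Vn] : exists n, forall v : V, (support_size (\val v : plane_sum R) <= n)%N.
    exists (\max_(i < r) support_size (b i : plane_sum R)) => v.
    have : subrep_set V (\val v) := set_valP v.
    move: (\val v) => {}v; rewrite VE => -[c ->].
    apply: (leq_trans (size_sum _ _ _)); apply/bigmax_leqP => i _.
    by apply: leq_trans (size_scale_leq _ _) _; exact: (leq_bigmax i).
  exists (fun i v => shift (i * n * d) (\val v : plane_sum R)); split=> [i|].
    split=> [a x y z ->|x y|g x]; first exact: shift_linear.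
      exact: shift_dot.
    exact: shift_rotate.
  have ort i j (x y : V) : (i < j)%N ->
      rep_ip (rotation_rep chi) (shift (i * n * d) (\val x : plane_sum R))
        (shift (j * n * d) (\val y : plane_sum R)) = 0.
    move=> ij; apply: (@shift_orthogonal _ _ n); first exact: Vn.
    rewrite -!mulnA; apply: leq_trans (leq_mul ij (leqnn (n * d)%N)).
    by rewrite mulSn addnC leq_add2r leq_pmulr.
  move=> i j ij x y; move: ij; rewrite neq_ltn => /orP[ij|ji]; first exact: ort.
  by rewrite rep_ipC; exact: ort.
- exists (unit_vector k0.*2).
    apply/eqP => x0; have := coord_unit_vector k0.*2 k0.*2.
    by rewrite x0 coord0 eqxx => /eqP; rewrite eq_sym oner_eq0.
  move=> g; apply/rotate_fixedP => k.
  have [->|kk0] := eqVneq k k0; [by left|right].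
  rewrite !coord_unit_vector; split; first by rewrite (inj_eq double_inj) (negbTE kk0).
  by case: eqP => // /(congr1 odd); rewrite /= !odd_double.
Qed.

End Periodic.

End RotationUniverse.

(** * Realization and the classification *)

Section Realization.
Local Open Scope ring_scope.
Variables (R : realType) (gT : finGroupType).

(** Let the [n + 1] characters with kernels [H_1, ..., H_n, G] act periodically
    on the planes. A stabilizer is then the intersection of the kernels on the
    planes where the vector is nonzero. *)
Lemma cocyclic_universe n (Hs : 'I_n -> {group gT}) :
  (forall i, cocyclic (Hs i)) ->
  exists U : orthogonal_rep R gT, [/\ is_universe U,
    forall i, exists x : U, stab_set x = Hs i &
    forall (x : U) g, (forall i, stab_set x \subset Hs i -> g \in Hs i) ->
      g \in stab_set x].
Proof.
move=> cHs; have [ch chP] := choice (fun i => cocyclic_character R (cHs i)).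
pose chi k := if insub (k %% n.+1)%N is Some i then ch i
              else trivial_character R gT.
have chiE (i : 'I_n) : chi i = ch i.
  by rewrite /chi modn_small ?valK // ltnS ltnW.
have chi_n : chi n = trivial_character R gT.
  by rewrite /chi modn_small // insubF // ltnn.
have chi_per k : chi (k + n.+1)%N = chi k by rewrite /chi modnDr.
exists (rotation_rep chi); split.
- apply: (rotation_universe (ltn0Sn n) chi_per).
  by exists n => g; rewrite chi_n.
- move=> i; exists (unit_vector R (i : nat).*2); apply/setP => g.
  apply/stabP/idP => [/rotate_fixedP/(_ i)|gH].
    rewrite coord_unit_vector eqxx chiE => -[/chP //|[/eqP]].
    by rewrite oner_eq0.
  apply/rotate_fixedP => k; have [->|ki] := eqVneq k i.
    by left; rewrite chiE; apply/chP.
  right; rewrite !coord_unit_vector (inj_eq double_inj) (negbTE ki); split=> //.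
  by case: eqP => // /(congr1 odd); rewrite /= !odd_double.
- move=> x g gH; apply/stabP/rotate_fixedP => k.
  have [|xk] := pselect (coord x k.*2 = 0 /\ coord x k.*2.+1 = 0); first by right.
  left; case chik : (insub (k %% n.+1)%N : option 'I_n) => [i|]; last first.
    by rewrite /chi chik.
  have chikE : chi k = ch i by rewrite /chi chik.
  rewrite chikE; apply/chP/gH/fintype.subsetP => h /stabP/rotate_fixedP/(_ k).
  by rewrite chikE => -[/chP|].
Qed.

End Realization.

Theorem theorem4p11 (R : realType) (gT : finGroupType)
    (abelianG : abelian [set: gT]%G)
    (T : subgroup_relation gT) (transferT : is_transfer_system T) :
  (exists U : orthogonal_rep R gT, is_universe U /\
     forall K H : {group gT}, T K H <-> steiner_transfer U K H)
  <->
  (exists (n : nat) (Hs : 'I_n -> {group gT}),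
     (forall i, cocyclic (Hs i)) /\
     forall K H : {group gT},
       T K H <-> generated_transfer_system
         (fun A B => exists2 i, A = Hs i & B = [set: gT]%G) K H).
Proof.
split=> [[U [_ TE]]|[n [Hs [cHs TE]]]].
  have [n [Hs [cHs UE]]] := orbit_transfer_cocyclic U abelianG.
  by exists n, Hs; split=> // K H; rewrite TE steiner_transferE UE.
have [U [univU Hs_stab stab_Hs]] := cocyclic_universe R cHs.
exists U; split=> // K H.
by rewrite TE steiner_transferE (orbit_transfer_generatedP Hs_stab stab_Hs).
Qed.
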